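(* For every integer $k \geq 4$, \[ \gamma^+(\{K_4^3, F_{3,2}, J_k\}) = \frac{k-2}{2k-3}.\]
   Context: All hypergraphs are $3$-graphs (every edge has size $3$). For a $3$-graph $H$, the co-degree of a pair of vertices is the number of edges containing it; the minimum positive co-degree $\delta_2^+(H)$ is the largest $k$ such that every pair contained in some edge is contained in at least $k$ edges (it is $0$ for the edgeless graph). For a family $\mathcal{F}$, $\mathrm{co^+ex}(n,\mathcal{F})$ is the maximum of $\delta_2^+(H)$ over $n$-vertex $3$-graphs $H$ containing no member of $\mathcal{F}$ as a (not necessarily induced) subhypergraph, and $\gamma^+(\mathcal{F})=\lim_{n\to\infty}\mathrm{co^+ex}(n,\mathcal{F})/n$ (the limit exists). $K_4^3$ is the complete $3$-graph on $4$ vertices. $F_{3,2}$ is the $3$-graph on $\{1,2,3,4,5\}$ with edges $\{123,124,125,345\}$. For $k\geq 3$, $J_k$ is the $3$-graph on $[k+1]$ with edges $\{1ij : 2\leq i<j\leq k+1\}$. *)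

(* Defs.v *)
From HB Require Import structures.
From mathcomp Require Import all_boot all_order all_algebra.
From mathcomp Require Import all_classical all_reals all_analysis.
Import Order.TTheory GRing.Theory Num.Theory.
Import numFieldNormedType.Exports.

Set Implicit Arguments.
Unset Strict Implicit.
Unset Printing Implicit Defensive.

Local Open Scope nat_scope.

Definition uniform3 (V : finType) (E : {set {set V}}) : bool :=
  [forall e in E, #|e| == 3].

Record graph3 (V : finType) := Graph3 {
  edges : {set {set V}};
  edges_uniform3 : uniform3 edges }.

HB.instance Definition _ (V : finType) := [isSub for @edges V].
HB.instance Definition _ (V : finType) := [Finite of graph3 V by <:].

Definition codegree (V : finType) (H : graph3 V) (p : {set V}) : nat :=
  #|[set e in edges H | p \subset e]|.

(* The bound on d loses nothing when H has an edge, since a codegree is at most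
   #|edges H|; when H has no edge, it leaves d = 0 only. *)
Definition min_pos_codegree (V : finType) (H : graph3 V) : nat :=
  \max_(d < #|edges H|.+1 |
      [forall p : {set V}, (#|p| == 2) && (0 < codegree H p) ==>
                           (d <= codegree H p)]) d.

Definition contains (V W : finType) (H : graph3 V) (G : graph3 W) : bool :=
  [exists f : {ffun W -> V},
     injectiveb f && [forall e in edges G, [set f x | x in e] \in edges H]].

(* Forbidden 3-graphs are taken up to isomorphism, on the vertex sets 'I_m;
   the type of all finite types is too large to be used here with set. *)
Definition some_graph3 := {m : nat & graph3 'I_m}.

Definition some_graph3_of (m : nat) (H : graph3 'I_m) : some_graph3 :=
  existT (fun m : nat => graph3 'I_m) m H.

Definition free (Fam : set some_graph3) (V : finType) (H : graph3 V) : Prop :=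
  forall G : some_graph3, Fam G -> ~~ contains H (projT2 G).

Definition coex_plus (n : nat) (Fam : set some_graph3) : nat :=
  \max_(H : graph3 'I_n | `[< free Fam H >]) min_pos_codegree H.

Definition coex_plus_density (R : realType) (Fam : set some_graph3) : R^nat :=
  fun n => ((coex_plus n Fam)%:R / n%:R)%R.

Definition gamma_plus (R : realType) (Fam : set some_graph3) : R :=
  limn (coex_plus_density R Fam).

Lemma cards3 (V : finType) (x y z : V) :
  uniq [:: x; y; z] -> #|[set x; y; z]| = 3.
Proof.
move=> /card_uniqP Uxyz; rewrite -[RHS]Uxyz; apply: eq_card => t.
by rewrite !inE orbA.
Qed.

Lemma uniform3_K43 : uniform3 [set e : {set 'I_4} | #|e| == 3].
Proof. by apply/forall_inP => e; rewrite inE. Qed.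

Definition K43 : graph3 'I_4 := Graph3 uniform3_K43.

(* In F32 and J the vertices are numbered from 0 instead of 1. *)
Definition F32_edges : {set {set 'I_5}} :=
  let v i (lt_i5 : i < 5) := Ordinal lt_i5 in
  let v0 := v 0 isT in let v1 := v 1 isT in let v2 := v 2 isT in
  let v3 := v 3 isT in let v4 := v 4 isT in
  [set [set v0; v1; v2]; [set v0; v1; v3]; [set v0; v1; v4];
       [set v2; v3; v4]].

Lemma uniform3_F32 : uniform3 F32_edges.
Proof.
apply/forall_inP => e; rewrite !inE -!orbA.
by case/or4P => /eqP ->; rewrite cards3.
Qed.

Definition F32 : graph3 'I_5 := Graph3 uniform3_F32.

Definition J_edges (k : nat) : {set {set 'I_k.+1}} :=
  [set e | [exists i : 'I_k.+1, exists j : 'I_k.+1,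
     (0 < i < j) && (e == [set ord0; i; j])]].

Lemma uniform3_J (k : nat) : uniform3 (J_edges k).
Proof.
apply/forall_inP => e; rewrite inE.
move=> /existsP[i /existsP[j /andP[/andP[i_gt0 lt_ij] /eqP->]]].
rewrite cards3 //= !inE negb_or -!val_eqE /=.
by rewrite !(ltn_eqF i_gt0) (ltn_eqF lt_ij) (ltn_eqF (ltn_trans i_gt0 lt_ij)).
Qed.

Definition J (k : nat) : graph3 'I_k.+1 := Graph3 (uniform3_J k).

(* Main.v *)
Require Import Defs.
From mathcomp Require Import all_boot all_order all_algebra.
From mathcomp Require Import zify lra.

(* Upper bound: among all cliques in links of vertices let X, in the link of z,
   have the maximum size m, so that m < k by J_k-freeness. Every vertex t
   satisfies m S(t) + G(t) <= m (m - 1), where S(t) counts the x in X such that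
   zxt is an edge, and G(t) counts the ordered pairs (x, y) of X such that xyt
   is an edge. Summing over t, with d the minimum positive co-degree, gives
   m^2 d + m (m - 1) d <= m (m - 1) n, that is,
   d / n <= (m - 1) / (2 m - 1) <= (k - 2) / (2 k - 3).

   Lower bound: colour the vertices with k colours, k - 1 of them on about
   n / (2 k - 3) vertices each and the last one on (k - 2) n / (2 k - 3) vertices,
   and take as edges the rainbow triples in which the last colour occurs. *)

Set Implicit Arguments.
Unset Strict Implicit.
Unset Printing Implicit Defensive.

Local Open Scope nat_scope.

(** * Edges as a symmetric relation on three vertices *)

Definition adj3 (V : finType) (H : graph3 V) (x y z : V) : bool :=
  [set x; y; z] \in edges H.

Lemma cards3_uniq (T : finType) (a b c : T) :
  (#|[set a; b; c]| == 3) = uniq [:: a; b; c].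
Proof.
have -> : #|[set a; b; c]| = #|[:: a; b; c]|.
  by apply: eq_card => t; rewrite !inE orbA.
exact/eqP/card_uniqP.
Qed.

Section Adjacency.
Variables (V : finType) (H : graph3 V).
Local Notation adj := (adj3 H).

Lemma adj3C x y z : adj x y z = adj y x z.
Proof. by rewrite /adj3 [[set x; y]]setUC. Qed.

Lemma adj3AC x y z : adj x y z = adj x z y.
Proof. by rewrite /adj3 setUAC. Qed.

Lemma adj3_rot x y z : adj x y z = adj y z x.
Proof. by rewrite adj3C adj3AC. Qed.

Lemma adj3_uniq x y z : adj x y z -> uniq [:: x; y; z].
Proof.
by rewrite -cards3_uniq; apply/(forall_inP (edges_uniform3 H)).
Qed.

Lemma adj3_neq12 x y z : adj x y z -> x != y.
Proof. by move/adj3_uniq; rewrite /= !inE negb_or -andbA => /and3P[]. Qed.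

Lemma adj3_neq13 x y z : adj x y z -> x != z.
Proof. by rewrite adj3AC; apply: adj3_neq12. Qed.

Lemma adj3_neq23 x y z : adj x y z -> y != z.
Proof. by rewrite adj3_rot; apply: adj3_neq12. Qed.

Lemma edge_set3 e : e \in edges H -> exists x y z, e = [set x; y; z].
Proof.
move=> eH; have := forall_inP (edges_uniform3 H) e eH.
case: {eH}cards_eqP => -[|x [|y [|z []]]] // _ _; exists x, y, z.
by apply/setP => t; rewrite !inE orbA.
Qed.

(** Sending [t] to [{x, y, t}] is a bijection from third vertices to the edges through the pair, so
    neighbours can be counted instead of edges. *)
Lemma codegree_pair x y : x != y -> codegree H [set x; y] = #|[set t | adj x y t]|.
Proof.
move=> neq_xy; rewrite /codegree.
have -> : [set e in edges H | [set x; y] \subset e] =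
          [set [set x; y; t] | t in [set t | adj x y t]].
  apply/setP => e; rewrite inE; apply/andP/imsetP => [[eH sub_e]|[t]].
    have /eqP e3 := forall_inP (edges_uniform3 H) e eH.
    have: #|e :\: [set x; y]| == 1.
      by rewrite cardsD (setIidPr sub_e) e3 cards2 neq_xy.
    move=> /cards1P[t et].
    have e_eq : e = [set x; y; t] by rewrite -et -{1}(setID e [set x; y]) (setIidPr sub_e).
    by exists t; rewrite // inE /adj3 -e_eq.
  by rewrite inE => xyt ->; split=> //; apply: subsetUl.
rewrite card_in_imset // => t u; rewrite !inE => xyt xyu /setP/(_ t).
rewrite !inE eqxx orbT => /esym; rewrite [t == x]eq_sym [t == y]eq_sym.
by rewrite (negPf (adj3_neq13 xyt)) (negPf (adj3_neq23 xyt)) => /eqP.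
Qed.

End Adjacency.

(** * Configurations that force a copy of a forbidden graph *)

Lemma imset_set3 (T U : finType) (f : T -> U) a b c :
  f @: [set a; b; c] = [set f a; f b; f c].
Proof. by rewrite !imsetU !imset_set1. Qed.

Lemma containsP (V W : finType) (H : graph3 V) (G : graph3 W) :
  reflect (exists2 f : W -> V, injective f &
             forall a b c, adj3 G a b c -> adj3 H (f a) (f b) (f c))
          (contains H G).
Proof.
apply: (iffP existsP) => [[f /andP[/injectiveP f_inj /forall_inP fE]] | [f f_inj fE]].
  by exists f => // a b c /fE; rewrite imset_set3.
exists (finfun f); apply/andP; split.
  by apply/injectiveP => a b; rewrite !ffunE => /f_inj.
apply/forall_inP => e eG; have [a [b [c abc]]] := edge_set3 eG.
by rewrite abc imset_set3 !ffunE; apply: fE; rewrite /adj3 -abc.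
Qed.

Lemma adj3_K43 a b c : adj3 K43 a b c = uniq [:: a; b; c].
Proof. by rewrite /adj3 inE cards3_uniq. Qed.

Lemma contains_K43 (V : finType) (H : graph3 V) x y z t :
  adj3 H x y z -> adj3 H x y t -> adj3 H x z t -> adj3 H y z t -> contains H K43.
Proof.
move=> xyz xyt xzt yzt; apply/containsP.
have uniq_xyzt : uniq [:: x; y; z; t].
  by rewrite /= !inE !negb_or (adj3_neq12 xyz) (adj3_neq13 xyz) (adj3_neq23 xyz)
             (adj3_neq13 xyt) (adj3_neq23 xyt) (adj3_neq23 xzt).
exists (tnth [tuple x; y; z; t]) => [|a b c];
  first exact: (tuple_uniqP [tuple of _] uniq_xyzt).
rewrite adj3_K43.
(* All orderings of the four edges give 24 facts, which settle the 64 triples of indices by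
   inspection. *)
have adj_perm u v w : adj3 H u v w ->
  [/\ adj3 H u w v, adj3 H v u w, adj3 H v w u, adj3 H w u v & adj3 H w v u].
  move=> uvw; split; [by rewrite -adj3AC | by rewrite adj3C | by rewrite -adj3_rot
                     | by rewrite adj3_rot | by rewrite adj3C -adj3_rot].
have [? ? ? ? ?] := adj_perm _ _ _ xyz; have [? ? ? ? ?] := adj_perm _ _ _ xyt.
have [? ? ? ? ?] := adj_perm _ _ _ xzt; have [? ? ? ? ?] := adj_perm _ _ _ yzt.
by case: a b c => [[|[|[|[|a]]]] ?] [[|[|[|[|b]]]] ?] [[|[|[|[|c]]]] ?].
Qed.

Lemma contains_F32 (V : finType) (H : graph3 V) x y a b c :
  adj3 H x y a -> adj3 H x y b -> adj3 H x y c -> adj3 H a b c ->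
  contains H F32.
Proof.
move=> xya xyb xyc abc; apply/containsP.
have uniq_xyabc : uniq [:: x; y; a; b; c].
  by rewrite /= !inE !negb_or (adj3_neq12 xya) (adj3_neq13 xya) (adj3_neq13 xyb)
    (adj3_neq13 xyc) (adj3_neq23 xya) (adj3_neq23 xyb) (adj3_neq23 xyc)
    (adj3_neq12 abc) (adj3_neq13 abc) (adj3_neq23 abc).
exists (tnth [tuple x; y; a; b; c]) => [|u v w];
  first exact: (tuple_uniqP [tuple of _] uniq_xyabc).
rewrite /adj3 -!imset_set3 /= !inE -!orbA => /or4P[] /eqP ->;
  by rewrite imset_set3 !(tnth_nth x).
Qed.

Lemma adj3_J0 k (i j : 'I_k.+1) : 0 < i -> 0 < j -> i != j -> adj3 (J k) ord0 i j.
Proof.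
move=> i0 j0; rewrite neq_ltn => /orP[ij|ji]; last rewrite adj3AC;
  rewrite /adj3 inE; apply/existsP.
  by exists i; apply/existsP; exists j; rewrite i0 ij eqxx.
by exists j; apply/existsP; exists i; rewrite j0 ji eqxx.
Qed.

(** Once [X] has two elements, this condition forces [z \notin X], since no edge repeats a
    vertex. *)
Definition link_clique (V : finType) (H : graph3 V) (z : V) (X : {set V}) : bool :=
  [forall x in X, forall y in X, (x != y) ==> adj3 H z x y].

Lemma link_cliqueP (V : finType) (H : graph3 V) z (X : {set V}) :
  reflect {in X &, forall x y, x != y -> adj3 H z x y} (link_clique H z X).
Proof.
apply: (iffP forall_inP) => [C x y xX yX|C x xX]; first exact/implyP/(forall_inP (C x xX)).
by apply/forall_inP => y yX; apply/implyP/C.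
Qed.

(** The centre [ord0] is sent to [z] and the other [k] vertices to distinct elements of [X]. *)
Lemma contains_J (V : finType) (H : graph3 V) k z (X : {set V}) :
  link_clique H z X -> 1 < k <= #|X| -> contains H (J k).
Proof.
move=> /link_cliqueP C /andP[k_gt1 le_k].
have zX : z \notin X.
  apply/negP => zX; have /card_gt1P[x [y [xX yX neq_xy]]] := leq_trans k_gt1 le_k.
  have no_z u : u \in X -> z != u -> False.
    by move=> uX /(C z u zX uX)/adj3_neq12; rewrite eqxx.
  case: (eqVneq z x) neq_xy => [<-|/(no_z x xX) //]; exact: no_z.
pose g (i : 'I_k) : V := enum_val (widen_ord le_k i).
have gX i : g i \in X by exact: enum_valP.
have g_inj : injective g by move=> i j /enum_val_inj /(congr1 val) ij; apply: val_inj.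
pose f a := if unlift ord0 a is Some i then g i else z.
have f0 : f ord0 = z by rewrite /f unlift_none.
have fS i : f (lift ord0 i) = g i by rewrite /f liftK.
apply/containsP; exists f => [a b|a b c].
  have gz i : g i != z by apply: contraNneq zX => <-.
  case: (unliftP ord0 a) => [i ->|->]; case: (unliftP ord0 b) => [j ->|->] //;
    rewrite ?f0 ?fS; first by move/g_inj ->.
    by move/eqP; rewrite (negPf (gz i)).
  by move/esym/eqP; rewrite (negPf (gz j)).
rewrite {1}/adj3 inE => /existsP[i /existsP[j /andP[/andP[i0 ij] /eqP abc]]].
rewrite /adj3 -imset_set3 abc imset_set3 f0.
case: (unliftP ord0 i) i0 ij => [i' ->|->] // _; case: (unliftP ord0 j) => [j' ->|->] // ij.
rewrite !fS; apply: C => //; rewrite (inj_eq g_inj).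
by apply: contraTneq ij => ->; rewrite ltnn.
Qed.

(** * Double counting *)

Lemma card_offdiag (T : finType) (X : {set T}) :
  #|[set u in setX X X | u.1 != u.2]| = #|X| * #|X|.-1.
Proof.
pose D := [set (x, x) | x in X].
have -> : [set u in setX X X | u.1 != u.2] = setX X X :\: D.
  apply/setP => -[x y]; rewrite !inE /= andbC.
  have [/andP[xX _]|] := boolP ((x \in X) && (y \in X)); rewrite ?andbF // !andbT.
  congr (~~ _); apply/eqP/imsetP => [<-|[w _ [-> ->]] //]; by exists x.
have DX : D \subset setX X X.
  by apply/subsetP => _ /imsetP[x xX ->]; rewrite inE /= xX.
rewrite cardsD cardsX (setIidPr DX) card_imset => [|x y [->//]].
by rewrite -subn1 mulnBr muln1.
Qed.

Lemma sum_card_fibers (T U : finType) (A : {set T}) (P : T -> U -> bool) :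
  \sum_t #|[set x in A | P x t]| = \sum_(x in A) #|[set t | P x t]|.
Proof.
under eq_bigr do rewrite -sum1_card big_mkcond /=.
rewrite exchange_big /= [RHS]big_mkcond /=; apply: eq_bigr => x _.
have [xA|xA] := ifPn; last by rewrite big1 // => t _; rewrite inE (negPf xA).
by rewrite -sum1_card [RHS]big_mkcond /=; apply: eq_bigr => t _; rewrite !inE xA.
Qed.

(** * Upper bound from a maximum link clique *)

Section UpperBound.
Variables (V : finType) (H : graph3 V).
Local Notation adj := (adj3 H).

Hypothesis K43_free : forall x y z t,
  adj x y z -> adj x y t -> adj x z t -> ~~ adj y z t.
Hypothesis F32_free : forall x y a b c,
  adj x y a -> adj x y b -> adj x y c -> ~~ adj a b c.

Variables (z : V) (X : {set V}).
Hypothesis X_clique : link_clique H z X.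
(** The maximum ranges over the links of all vertices: [weight] compares [X] with a clique in the
    link of one of its own elements. *)
Hypothesis X_max : forall z' Y, link_clique H z' Y -> #|Y| <= #|X|.
Hypothesis X_gt1 : 1 < #|X|.

Let S t := [set x in X | adj z x t].
Let G t := [set u in setX X X | adj u.1 u.2 t].

Let adjX x y : x \in X -> y \in X -> x != y -> adj z x y.
Proof. exact: (link_cliqueP _ _ _ X_clique). Qed.

(** If all of [X] were in [S t], then [t |: X] would be a larger clique in the link of [z]. *)
Let card_S t : #|S t| <= #|X|.-1.
Proof.
have subX : S t \subset X by apply/subsetP => x; rewrite inE => /andP[].
have [SX|] := eqVneq (S t) X; last first.
  by rewrite eqEcard subX /= -ltnNge; case: #|X|.
have Xt x : x \in X -> adj z x t by rewrite -SX inE => /andP[].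
have tX : t \notin X by apply/negP => /Xt/adj3_neq23; rewrite eqxx.
suff /X_max : link_clique H z (t |: X) by rewrite cardsU1 tX add1n ltnn.
apply/link_cliqueP => x y; rewrite !inE.
move=> /predU1P[->|xX] /predU1P[->|yX]; first by rewrite eqxx.
- by rewrite adj3AC Xt.
- by rewrite Xt.
- exact: adjX.
Qed.

Let card_G t : #|G t| <= #|X| * #|X|.-1.
Proof.
rewrite -card_offdiag; apply: subset_leq_card; apply/subsetP => -[x y].
by rewrite !inE /= => /andP[-> /adj3_neq12].
Qed.

(* If [xy] is a pair of [G t], then [S t] cannot leave [{x, y}] by
   [F32]-freeness and cannot fill it by [K43]-freeness. *)
Let weight t : #|X| * #|S t| + #|G t| <= #|X| * #|X|.-1.
Proof.
have [->|[[x y]]] := set_0Vmem (G t).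
  by rewrite cards0 addn0 leq_mul2l card_S orbT.
rewrite !inE /= => /andP[/andP[xX yX] xyt].
have [->|[w]] := set_0Vmem (S t); first by rewrite cards0 muln0 card_G.
rewrite inE => /andP[wX zwt].
have G_S u v i : u \in X -> v \in X -> adj u v t -> i \in X -> adj z i t ->
    (i == u) || (i == v).
  move=> uX vX uvt iX zit; apply: contraT; rewrite negb_or => /andP[iu iv].
  by have := F32_free (adjX iX uX iu) (adjX iX vX iv) zit; rewrite uvt.
wlog wx : x y xX yX xyt / w = x.
  move=> WL; have /orP[/eqP|/eqP] := G_S x y w xX yX xyt wX zwt; first exact: (WL x y).
  by apply: (WL y x) => //; rewrite adj3C.
rewrite {w}wx in wX zwt *.
have zxy := adjX xX yX (adj3_neq12 xyt).
have zyt : ~~ adj z y t by apply: contraL xyt => zyt; exact: (K43_free zxy zwt zyt).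
have S1 : S t = [set x].
  apply/setP => i; rewrite !inE; apply/andP/eqP => [[iX zit]|-> //].
  by have /orP[/eqP//|/eqP iy] := G_S x y i xX yX xyt iX zit; rewrite -iy zit in zyt.
(* The link of [x] contains the triangle [z, y, t]. *)
have X_gt2 : 2 < #|X|.
  have := @X_max x [set z; y; t]; rewrite (eqP (_ : #|_| == 3)); last first.
    by rewrite cards3_uniq /= !inE negb_or (adj3_neq13 zxy) (adj3_neq13 zwt)
               (adj3_neq23 xyt).
  apply; apply/link_cliqueP => u v; rewrite !inE -!orbA.
  have xzy : adj x z y by rewrite adj3C.
  have xzt : adj x z t by rewrite adj3C.
  by case/or3P => /eqP -> /or3P[] /eqP -> //; rewrite ?eqxx // adj3AC.
have G2 : G t \subset [set (x, y); (y, x)].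
  have G_x v : v \in X -> adj x v t -> v = y.
    move=> vX xvt; apply/eqP; apply: contraT => vy.
    have xtz : adj x t z by rewrite -adj3_rot.
    have xty : adj x t y by rewrite adj3AC.
    have xtv : adj x t v by rewrite adj3AC.
    (* Otherwise the edge [zvy] lies in the common neighbourhood of [x] and [t]. *)
    by have := F32_free xtz xtv xty; rewrite (adjX vX yX vy).
  apply/subsetP => -[u v]; rewrite !inE /= => /andP[/andP[uX vX] uvt].
  (* Since [x] is in [S t], every pair of [G t] contains [x]; by [G_x] its other element is [y]. *)
  have /orP[/eqP xu|/eqP xv] := G_S u v x uX vX uvt xX zwt; subst.
    by rewrite (G_x v) // eqxx.
  by rewrite (G_x u) ?eqxx ?orbT // adj3C.
have G_le2 : #|G t| <= 2.
  by apply: leq_trans (subset_leq_card G2) _; rewrite cards2 ltnS leq_b1.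
(* With [m = #|X|], the left side is at most [m + 2 <= 2 m <= m (m - 1)]; the last step uses
   [X_gt2]. *)
rewrite S1 cards1 muln1; apply: leq_trans (_ : #|X| * 2 <= _).
  by rewrite muln2 -addnn leq_add2l (leq_trans G_le2) // ltnW.
by rewrite leq_mul2l -ltnS prednK ?X_gt2 ?orbT // ltnW.
Qed.

(** Summing [weight] over [t] and cancelling one factor [#|X|] gives the bound, with
    [(2 * m).-1 = m + m.-1] collecting the contributions of [S] and [G]. *)
Lemma codegree_clique_bound d :
  (forall x y t, adj x y t -> d <= #|[set t | adj x y t]|) ->
  d * (2 * #|X|).-1 <= #|X|.-1 * #|V|.
Proof.
move=> d_le; set m := #|X|.
have sumS : m * d <= \sum_t #|S t|.
  rewrite (sum_card_fibers X (fun x t => adj z x t)).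
  rewrite -sum_nat_const; apply: leq_sum => x xX.
  (* One of [u], [v] differs from [x] and forms an edge with [z] and [x], so the pair [zx] has
     positive codegree. *)
  have /card_gt1P[u [v [uX vX uv]]] := X_gt1.
  have [xu|xu] := eqVneq x u; last exact: d_le (adjX xX uX xu).
  by apply: d_le (adjX xX vX _); rewrite xu.
have sumG : m * m.-1 * d <= \sum_t #|G t|.
  rewrite (sum_card_fibers (setX X X) (fun u t => adj u.1 u.2 t)).
  rewrite -card_offdiag -sum_nat_const.
  rewrite [leqLHS](_ : _ = \sum_(u in setX X X | u.1 != u.2) d); last first.
    by apply: eq_bigl => u; rewrite inE.
  rewrite [leqRHS](bigID (fun u => u.1 != u.2)) /=.
  apply: leq_trans (leq_addr _ _); apply: leq_sum => -[x y] /=.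
  rewrite inE /= => /andP[/andP[xX yX] xy].
  have := adjX xX yX xy; rewrite adj3_rot; exact: d_le.
have : \sum_t (m * #|S t| + #|G t|) <= #|V| * (m * m.-1).
  by rewrite -sum_nat_const; apply: leq_sum => t _; exact: weight.
rewrite big_split /= -big_distrr /= => le_total.
have m_gt0 : 0 < m by exact: ltnW.
rewrite -(leq_pmul2l m_gt0) [m * (_ * #|V|)]mulnA [leqRHS]mulnC.
apply: leq_trans le_total.
rewrite (_ : (2 * m).-1 = m + m.-1); last by lia.
by rewrite !mulnDr ![d * _]mulnC [m * (m.-1 * d)]mulnA leq_add // leq_mul2l sumS orbT.
Qed.

End UpperBound.

Lemma min_pos_codegree_le (V : finType) (H : graph3 V) k : 2 < k ->
  ~~ contains H K43 -> ~~ contains H F32 -> ~~ contains H (J k) ->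
  min_pos_codegree H * (2 * k - 3) <= (k - 2) * #|V|.
Proof.
move=> k_gt2 K43_free F32_free J_free.
(* Dividing isolates the maximum, so that each candidate [d] can be bounded separately. *)
rewrite -leq_divRL; last by lia.
apply/bigmax_leqP => d /forall_inP d_le; rewrite leq_divRL; last by lia.
have [/existsP[z /existsP[x /existsP[y zxy]]]|no_edge] :=
    boolP [exists z, exists x, exists y, adj3 H z x y]; last first.
  suff edges0 : edges H = set0.
    by case: d {d_le} => d /=; rewrite edges0 cards0 ltnS leqn0 => /eqP->.
  apply/setP => e; rewrite inE; apply/negbTE; apply: contra no_edge => eH.
  have [a [b [c abc]]] := edge_set3 eH.
  apply/existsP; exists a; apply/existsP; exists b; apply/existsP; exists c.
  by rewrite /adj3 -abc.
have clique2 : link_clique H z [set x; y].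
  apply/link_cliqueP => u v; rewrite !inE => /orP[]/eqP-> /orP[]/eqP->;
    rewrite ?eqxx // => _; by rewrite adj3AC.
(* The centre and the clique are maximised together; the pair from an edge at [z] starts the search
   and gives size at least 2. *)
case: (arg_maxnP (P := fun u : V * {set V} => link_clique H u.1 u.2)
                 (fun u => #|u.2|) (i0 := (z, [set x; y])) clique2).
move=> [z' X] /= X_clique X_max.
have {}X_max v Y : link_clique H v Y -> #|Y| <= #|X| by move=> /(X_max (v, Y)).
have X_gt1 : 1 < #|X| by have := X_max _ _ clique2; rewrite cards2 (adj3_neq23 zxy).
have X_ltk : #|X| < k.
  rewrite ltnNge; apply: contra J_free => le_kX.
  by apply: (contains_J X_clique); rewrite (ltnW k_gt2).
have d_le3 a b t : adj3 H a b t -> d <= #|[set t | adj3 H a b t]|.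
  move=> abt; have ab := adj3_neq12 abt.
  rewrite -codegree_pair //; apply: d_le; rewrite cards2 ab /= codegree_pair //.
  by apply/card_gt0P; exists t; rewrite inE.
have K43_free' a b c t : adj3 H a b c -> adj3 H a b t -> adj3 H a c t -> ~~ adj3 H b c t.
  by move=> abc abt act; apply: contra K43_free; apply: contains_K43 abc abt act.
have F32_free' u v a b c : adj3 H u v a -> adj3 H u v b -> adj3 H u v c -> ~~ adj3 H a b c.
  by move=> uva uvb uvc; apply: contra F32_free; apply: contains_F32 uva uvb uvc.
have := codegree_clique_bound K43_free' F32_free' X_clique X_max X_gt1 d_le3.
move: X_gt1 X_ltk; move: #|X| #|V| (nat_of_ord d) => m n c m_gt1 m_ltk bound.
(* This is the monotonicity of [(m - 1) / (2 m - 1)] in [m], cross-multiplied, for [m <= k - 1]. *)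
have mono : m.-1 * (2 * k - 3) <= (k - 2) * (2 * m).-1 by nia.
have m2_gt0 : 0 < (2 * m).-1 by lia.
rewrite -(leq_pmul2r m2_gt0); apply: leq_trans (_ : m.-1 * n * (2 * k - 3) <= _).
  by rewrite mulnAC leq_mul2r bound orbT.
by rewrite mulnAC [leqRHS]mulnAC leq_mul2r mono orbT.
Qed.

(** * Lower bound: the rainbow construction *)

Section RainbowGraph.
Variables (V : finType) (p : nat) (g : V -> 'I_p.+2).

(** The construction has [p = k - 2], hence [k] colours, with [ord_max] as the last colour. *)
Definition rainbow_edges : {set {set V}} :=
  [set e : {set V} | [&& #|e| == 3, #|g @: e| == 3 & ord_max \in g @: e]].

Lemma uniform3_rainbow : uniform3 rainbow_edges.
Proof. by apply/forall_inP => e; rewrite inE => /and3P[]. Qed.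

Definition rainbow_graph : graph3 V := Graph3 uniform3_rainbow.

Lemma adj3_rainbow x y z : adj3 rainbow_graph x y z =
  uniq [:: g x; g y; g z] && (ord_max \in [:: g x; g y; g z]).
Proof.
rewrite /adj3 inE imset_set3 !cards3_uniq !inE -!orbA.
have [guniq|_] := boolP (uniq [:: g x; g y; g z]); last by rewrite andbF.
suff -> : uniq [:: x; y; z] by [].
exact: (@map_uniq _ _ g [:: x; y; z]).
Qed.

Lemma rainbow_neq (W : finType) (G : graph3 W) (f : W -> V) a b c :
  (forall a b c, adj3 G a b c -> adj3 rainbow_graph (f a) (f b) (f c)) ->
  adj3 G a b c -> g (f a) != g (f b).
Proof.
move=> fG /fG; rewrite adj3_rainbow /= !inE negb_or.
by case/andP=> /andP[/andP[]].
Qed.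

(** Four vertices of a copy would have distinct colours, so some three of them avoid the last colour
    and cannot form an edge. *)
Lemma rainbow_K43_free : ~~ contains rainbow_graph K43.
Proof.
apply/negP => /containsP[f _ fE].
have c_inj a b c : uniq [:: a; b; c] -> g (f a) != g (f b).
  by rewrite -adj3_K43; exact: rainbow_neq.
have c_max a b c : uniq [:: a; b; c] ->
    [|| ord_max == g (f a), ord_max == g (f b) | ord_max == g (f c)].
  by rewrite -adj3_K43 => /fE; rewrite adj3_rainbow !inE => /andP[].
pose v i (lt_i : i < 4) := Ordinal lt_i.
pose v0 := v 0 isT; pose v1 := v 1 isT; pose v2 := v 2 isT; pose v3 := v 3 isT.
have no a b : ord_max = g (f a) -> ord_max == g (f b) ->
    (exists c, uniq [:: a; b; c]) -> False.
  by move=> am /eqP bm [c /c_inj]; rewrite -am -bm eqxx.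
case/or3P: (c_max v0 v1 v2 isT) => /eqP mi.
- by case/or3P: (c_max v1 v2 v3 isT) => /(no _ _ mi); apply; [exists v2|exists v1|exists v1].
- by case/or3P: (c_max v0 v2 v3 isT) => /(no _ _ mi); apply; [exists v2|exists v0|exists v0].
- by case/or3P: (c_max v0 v1 v3 isT) => /(no _ _ mi); apply; [exists v1|exists v0|exists v0].
Qed.

(** The edge [234] contains the last colour, and each of its vertices lies in an edge with [0] and
    [1], so neither [0] nor [1] has that colour. The edges [012] and [013] then give it to both [2]
    and [3], although [234] is rainbow. *)
Lemma rainbow_F32_free : ~~ contains rainbow_graph F32.
Proof.
apply/negP => /containsP[f _ fE].
pose v i (lt_i : i < 5) := Ordinal lt_i.
pose v0 := v 0 isT; pose v1 := v 1 isT; pose v2 := v 2 isT.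
pose v3 := v 3 isT; pose v4 := v 4 isT.
have E a b c : [set a; b; c] \in F32_edges ->
   uniq [:: g (f a); g (f b); g (f c)] && (ord_max \in [:: g (f a); g (f b); g (f c)]).
  by move=> abc; rewrite -adj3_rainbow; apply: fE.
have := E v0 v1 v2; have := E v0 v1 v3; have := E v0 v1 v4; have := E v2 v3 v4.
rewrite !inE !eqxx ?orbT => /(_ isT) + /(_ isT) + /(_ isT) + /(_ isT).
move: (g (f v0)) (g (f v1)) (g (f v2)) (g (f v3)) (g (f v4)) => c0 c1 c2 c3 c4.
rewrite /= !inE !negb_or -!andbA.
case/and4P=> n23 n24 n34 max_234.
case/and4P=> n01 n04 n14 _ /and4P[_ n03 n13 max_013] /and4P[_ n02 n12 max_012].
have max01 : (ord_max != c0) && (ord_max != c1).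
  by case/or3P: max_234 => /eqP->; rewrite ![_ == c0]eq_sym ![_ == c1]eq_sym
     ?n02 ?n12 ?n03 ?n13 ?n04 ?n14.
move: max01 max_012 max_013 => /andP[/negPf-> /negPf->] /eqP m2 /eqP m3.
by rewrite -m2 -m3 eqxx in n23.
Qed.

(** Any two vertices of [J k] share an edge, so a copy would need [k + 1] colours, more than the
    [p + 2] available. *)
Lemma rainbow_J_free k : p.+1 < k -> ~~ contains rainbow_graph (J k).
Proof.
move=> lt_pk; apply/negP => /containsP[f _ fE].
suff /leq_card : injective (g \o f) by rewrite !card_ord ltnS leqNgt lt_pk.
have c_neq (i j : 'I_k.+1) : 0 < i -> 0 < j -> i != j -> g (f i) != g (f j).
  move=> i0 j0 ij; have := adj3_J0 i0 j0 ij.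
  by rewrite adj3_rot; exact: rainbow_neq.
have c_neq0 (i : 'I_k.+1) : 0 < i -> g (f ord0) != g (f i).
  move=> i0.
  have [j /andP[j0 ij]] : exists j : 'I_k.+1, (0 < j) && (i != j).
    have [i1|i1] := eqVneq (i : nat) 1.
      by exists (inord 2); rewrite -val_eqE /= inordK ?i1 //; lia.
    by exists (inord 1); rewrite -val_eqE /= inordK ?i1 //; lia.
  exact: rainbow_neq fE (adj3_J0 i0 j0 ij).
move=> i j /= /eqP; apply: contraTeq => ij.
case: (posnP i) => [i0|i0]; case: (posnP j) => [j0|j0].
- by rewrite -val_eqE /= i0 j0 in ij.
- by rewrite (_ : i = ord0) ?c_neq0 //; apply: val_inj.
- by rewrite (_ : j = ord0) 1?eq_sym ?c_neq0 //; apply: val_inj.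
- exact: c_neq.
Qed.

(** A pair inside an edge either avoids the last colour, and its neighbours are the whole last
    class, or has the last colour and another colour [c], and its neighbours are all vertices of
    neither colour. *)
Lemma rainbow_min_pos_codegree d :
  d <= #|[set t | g t == ord_max]| ->
  (forall c, c != ord_max -> d <= #|[set t | (g t != ord_max) && (g t != c)]|) ->
  d <= min_pos_codegree rainbow_graph.
Proof.
move=> d_max d_other; have [->//|d_gt0] := posnP d.
(* An actual edge is built from [a], [a'], [b], because [min_pos_codegree] ranges only over [d] up
   to the number of edges. *)
have [b] : exists b, b \in [set t | g t == ord_max] by apply/card_gt0P/(leq_trans d_gt0).
rewrite inE => /eqP gb.
have pick_other c : c != ord_max -> exists2 t, g t != ord_max & g t != c.
  move=> /d_other /(leq_trans d_gt0) /card_gt0P[t]; rewrite inE => /andP[]; by exists t.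
have [a a_max _] := pick_other ord0 isT.
have [a' a'_max a'a] := pick_other _ a_max.
have codeg x y t : adj3 rainbow_graph x y t -> d <= codegree rainbow_graph [set x; y].
  move=> xyt; rewrite codegree_pair ?(adj3_neq12 xyt) //.
  have gxy : g x != g y.
    by move: xyt; rewrite adj3_rainbow /= !inE negb_or => /andP[/andP[/andP[]]].
  have [xM|xM] := eqVneq (g x) ord_max.
    have yM : g y != ord_max by rewrite -xM eq_sym.
    apply: leq_trans (d_other _ yM) _; apply: subset_leq_card; apply/subsetP => u.
    rewrite !inE adj3_rainbow /= !inE xM eqxx andbT negb_or.
    by rewrite ![ord_max == _]eq_sym ![g y == _]eq_sym => /andP[-> ->]; rewrite eq_sym yM.
  have [yM|yM] := eqVneq (g y) ord_max.
    apply: leq_trans (d_other _ xM) _; apply: subset_leq_card; apply/subsetP => u.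
    rewrite !inE adj3_rainbow /= !inE yM eqxx orbT andbT negb_or xM.
    by rewrite ![ord_max == _]eq_sym ![g x == _]eq_sym => /andP[-> ->].
  apply: leq_trans d_max _; apply: subset_leq_card; apply/subsetP => u.
  rewrite !inE adj3_rainbow /= !inE => /eqP->; rewrite eqxx !orbT andbT negb_or.
  by rewrite gxy xM yM.
have aa'b : adj3 rainbow_graph a a' b.
  by rewrite adj3_rainbow /= !inE gb eqxx !orbT negb_or a_max a'_max eq_sym a'a.
have d_lt : d < #|edges rainbow_graph|.+1.
  rewrite ltnS (leq_trans (codeg _ _ _ aa'b)) // subset_leq_card //.
  by apply/subsetP => e; rewrite inE => /andP[].
apply: (@bigmax_sup _ (Ordinal d_lt)) => //; apply/forallP => e; apply/implyP => /andP[].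
move=> /cards2P[x [y [xy ->]]].
rewrite codegree_pair // => /card_gt0P[t]; rewrite inE => xyt.
by rewrite -codegree_pair //; exact: codeg xyt.
Qed.

End RainbowGraph.

(** Each of the [n %/ N] full blocks of length [N] contributes one element of [A] for each of the
    [p] residues [rho j]. *)
Lemma card_residues n N p (rho : 'I_p -> nat) (A : {set 'I_n}) :
  injective rho -> (forall j, rho j < N) ->
  (forall (i : 'I_n) j, i %% N = rho j -> i \in A) -> p * (n %/ N) <= #|A|.
Proof.
move=> rho_inj rho_lt rhoA.
have lt_n (u : 'I_p * 'I_(n %/ N)) : u.2 * N + rho u.1 < n.
  apply: leq_trans (leq_trunc_div n N); apply: (@leq_trans (u.2.+1 * N)).
    by rewrite mulSn addnC ltn_add2r.
  by rewrite leq_mul2r ltn_ord orbT.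
pose f u := Ordinal (lt_n u).
have f_mod u : f u %% N = rho u.1 by rewrite /= modnMDl modn_small.
have f_inj : injective f.
  move=> [j u] [j' u'] /(congr1 val) ff.
  have jj : j = j' by apply: rho_inj; rewrite -(f_mod (j, u)) -(f_mod (j', u')) ff.
  move: ff; rewrite /= jj => /addIn/eqP; rewrite eqn_mul2r => /orP[/eqP N0|/eqP uu].
    by have := leq_trans (rho_lt j) (eq_leq N0).
  by congr (_, _) => //; apply: val_inj.
rewrite -[p]card_ord -[n %/ N]card_ord -card_prod -(card_imset _ f_inj).
by apply: subset_leq_card; apply/subsetP => _ /imsetP[u _ ->]; apply: rhoA (f_mod u).
Qed.

Lemma rainbow_coex n p : exists g : 'I_n -> 'I_p.+2,
  p * (n %/ (2 * p).+1) <= min_pos_codegree (rainbow_graph g).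
Proof.
(* In each period of length [2 p + 1], the residues [0] to [p] get a colour of their own and the [p]
   residues from [p + 1] to [2 p] all get the last colour. *)
pose g (i : 'I_n) : 'I_p.+2 := inord (minn (i %% (2 * p).+1) p.+1).
have gE i : val (g i) = minn (i %% (2 * p).+1) p.+1 by rewrite /= inordK // ltnS geq_minr.
exists g; apply: rainbow_min_pos_codegree => [|c c_max].
  apply: (@card_residues _ _ _ (fun j => p.+1 + j)) => [j j' /addnI/val_inj//|j|i j ij].
    by have := ltn_ord j; lia.
  by rewrite inE -val_eqE gE ij /= (minn_idPr _) // leq_addr.
have c_le : c <= p by move: c_max (ltn_ord c); rewrite -val_eqE /=; lia.
(* [bump c] lists the [p] residues up to [p] other than [c]. *)
apply: (@card_residues _ _ _ (fun j : 'I_p => bump c j))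
  => [j j' /(can_inj (bumpK _))/val_inj//|j|i j ij].
  by have := ltn_ord j; rewrite /bump; lia.
rewrite inE -!val_eqE !gE ij /= (minn_idPl _); last by have := ltn_ord j; rewrite /bump; lia.
rewrite andbC eq_sym neq_bump /=.
by have := ltn_ord j; rewrite /bump; lia.
Qed.

(* Passage to the limit *)
From mathcomp Require Import all_classical all_reals all_analysis.
Import Order.TTheory GRing.Theory Num.Theory.
Import numFieldNormedType.Exports.

Local Open Scope classical_set_scope.
Local Open Scope ring_scope.

(** The loss [k - 2] in the second inequality comes from the incomplete last period: only
    [n %/ (2 * k - 3)] full periods are counted. *)
Lemma coex_plus_bounds (k n : nat) : (4 <= k)%N ->
  let Fam : set some_graph3 :=
    [set some_graph3_of K43; some_graph3_of F32; some_graph3_of (J k)] in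
  (coex_plus n Fam * (2 * k - 3) <= (k - 2) * n)%N /\
  ((k - 2) * n <= (coex_plus n Fam + (k - 2)) * (2 * k - 3))%N.
Proof.
move=> k_ge4 Fam; split.
  rewrite -leq_divRL; last by lia.
  apply/bigmax_leqP => H /asboolP H_free; rewrite leq_divRL; last by lia.
  rewrite -[n in leqRHS]card_ord; apply: min_pos_codegree_le; first by lia.
  - by apply: (H_free (some_graph3_of K43)); left; left.
  - by apply: (H_free (some_graph3_of F32)); left; right.
  - by apply: (H_free (some_graph3_of (J k))); right.
have [g g_codeg] := rainbow_coex n (k - 2).
have g_free : Defs.free Fam (rainbow_graph g).
  move=> _ [[->|->]|->]; [exact: rainbow_K43_free | exact: rainbow_F32_free |].
  by apply: rainbow_J_free; lia.
have : ((k - 2) * (n %/ (2 * (k - 2)).+1) <= coex_plus n Fam)%N.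
  by apply: leq_trans g_codeg _; apply: leq_bigmax_cond; apply/asboolP.
rewrite (_ : (2 * (k - 2)).+1 = (2 * k - 3)%N); last by lia.
move=> le_coex.
have n_lt : (n <= (n %/ (2 * k - 3)).+1 * (2 * k - 3))%N.
  by rewrite ltnW // ltn_ceil //; lia.
apply: (@leq_trans ((k - 2) * ((n %/ (2 * k - 3)).+1 * (2 * k - 3)))).
  by rewrite leq_mul2l n_lt orbT.
by rewrite mulnA leq_mul2r mulnS addnC leq_add2r le_coex orbT.
Qed.

Theorem theorem2p2 (R : realType) (k : nat) (hk : (4 <= k)%N) :
  let Fam : set some_graph3 :=
    [set some_graph3_of K43; some_graph3_of F32; some_graph3_of (J k)] in
  cvgn (coex_plus_density R Fam) /\
  gamma_plus R Fam = (k%:R - 2) / (2 * k%:R - 3).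
Proof.
move=> Fam.
suff cvg_density : coex_plus_density R Fam @ \oo --> ((k%:R - 2) / (2 * k%:R - 3) : R).
  split; first by apply/cvg_ex; eexists; exact: cvg_density.
  exact: (cvg_lim (@norm_hausdorff _ _) cvg_density).
set L := (X in _ --> X).
have k_ge4 : (4 <= k%:R :> R) by rewrite (ler_nat R 4 k).
have den_gt0 : 0 < 2 * k%:R - 3 :> R by lra.
have E2 : (k - 2)%:R = k%:R - 2 :> R by rewrite natrB //; lia.
have E3 : (2 * k - 3)%:R = 2 * k%:R - 3 :> R by rewrite natrB ?natrM //; lia.
(* The subtracted term is the loss [k - 2] of [coex_plus_bounds] divided by the number of
   vertices. *)
have lower_cvg : (fun n => L - (k%:R - 2) * (n.+1%:R)^-1) @ \oo --> L.
  rewrite -[X in _ --> X]subr0; apply: cvgB; first exact: cvg_cst.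
  rewrite -[X in _ --> X](mulr0 (k%:R - 2)); apply: cvgM; first exact: cvg_cst.
  exact: cvg_harmonic.
(* The shift keeps the number of vertices positive, so that division by it is meaningful. *)
rewrite -(cvg_shiftS (coex_plus_density R Fam)).
apply: (squeeze_cvgr _ lower_cvg (cvg_cst L)).
apply: nearW => n; have [upper lower] := coex_plus_bounds n.+1 hk.
rewrite /coex_plus_density -/Fam /=; move: upper lower; rewrite -/Fam.
move: (coex_plus _ _) => c.
have n_gt0 : 0 < n.+1%:R :> R by rewrite ltr0n.
rewrite -!(ler_nat R) !natrM natrD E2 E3 => upper lower.
apply/andP; split.
  rewrite lerBlDr -mulrDl ler_pdivlMr // /L mulrAC ler_pdivrMr //.
by rewrite /L ler_pdivrMr // mulrAC ler_pdivlMr.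
Qed.
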